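(* Let $n\geq 3$ be a natural number. Then $PS_n\simeq B_n/P_n'$ (isomorphism of groups), where $P_n'=[P_n,P_n]$ is the commutator subgroup of the pure braid group $P_n$.
   Context: For $n\geq 3$, $B_n$ denotes the braid group on $n$ strands: generators $\sigma_i$, $1\leq i\leq n-1$, and relations $\sigma_i\sigma_j=\sigma_j\sigma_i$ if $|i-j|\geq 2$, and $\sigma_i\sigma_{i+1}\sigma_i=\sigma_{i+1}\sigma_i\sigma_{i+1}$ for $1\leq i\leq n-2$. The pure braid group $P_n$ is the kernel of the canonical surjective homomorphism $\pi:B_n\to S_n$, $\pi(\sigma_i)=s_i$, where $s_i=(i,i+1)$. The pseudosymmetric group $PS_n$ is the group with generators $\sigma_i$, $1\leq i\leq n-1$, subject to the relations $\sigma_i\sigma_j=\sigma_j\sigma_i$ if $|i-j|\geq 2$, and $\sigma_i\sigma_{i+1}\sigma_i=\sigma_{i+1}\sigma_i\sigma_{i+1}$ for $1\leq i\leq n-2$, together with $\sigma_i\sigma_{i+1}^{-1}\sigma_i=\sigma_{i+1}\sigma_i^{-1}\sigma_{i+1}$ for $1\leq i\leq n-2$ (equivalently, together with $\sigma_i^2\sigma_{i+1}^2=\sigma_{i+1}^2\sigma_i^2$ for $1\leq i\leq n-2$). For a group $G$, $G'$ denotes the subgroup generated by all commutators $[x,y]=x^{-1}y^{-1}xy$ with $x,y\in G$. *)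

(* Defs.v *)
From HB Require Import structures.
From mathcomp Require Import fingroup perm boolp zify all_boot.

Set Implicit Arguments.
Unset Strict Implicit.
Unset Printing Implicit Defensive.

Local Open Scope quotient_scope.
Local Open Scope group_scope.

(* The letter (i, true) is the generator i, the letter (i, false) its formal
   inverse. A presentation is a relation [r] on words: [r u v] means that
   u = v is one of the defining relations. *)
Definition word (I : Type) := seq (I * bool).

Inductive word_eq (I : Type) (r : word I -> word I -> Prop) :
    word I -> word I -> Prop :=
  | WordRel u v of r u v : word_eq r u v
  | WordCancel i b : word_eq r [:: (i, b); (i, ~~ b)] [::]
  | WordCat u u' v v' of word_eq r u u' & word_eq r v v' :
      word_eq r (u ++ v) (u' ++ v')
  | WordRefl u : word_eq r u u
  | WordSym u v of word_eq r u v : word_eq r v u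
  | WordTrans v u w of word_eq r u v & word_eq r v w : word_eq r u w.

Section Presented.
Variables (I : choiceType) (r : word I -> word I -> Prop).

Definition word_eqb : rel (word I) := fun u v => `[< word_eq r u v >].

Lemma word_eqb_refl : reflexive word_eqb.
Proof. by move=> u; apply/asboolP/WordRefl. Qed.

Lemma word_eqb_sym : symmetric word_eqb.
Proof. by move=> u v; apply/asboolP/asboolP => /WordSym. Qed.

Lemma word_eqb_trans : transitive word_eqb.
Proof.
by move=> v u w /asboolP uv /asboolP vw; apply/asboolP/(WordTrans uv vw).
Qed.

Canonical word_equiv := EquivRel word_eqb
  word_eqb_refl word_eqb_sym word_eqb_trans.

Definition presented : Type := {eq_quot word_equiv}.

HB.instance Definition _ := EqQuotient.on presented.
HB.instance Definition _ := Choice.on presented.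

Lemma presented_eqP u v : \pi_presented u = \pi_presented v <-> word_eq r u v.
Proof.
by split=> [/(@eqmodP _ word_equiv)/asboolP|/asboolP/(@eqmodP _ word_equiv)].
Qed.

Lemma presented_reprP u : word_eq r (repr (\pi_presented u)) u.
Proof. by apply/presented_eqP; rewrite reprK. Qed.

Definition word_inv (u : word I) : word I := rev [seq (l.1, ~~ l.2) | l <- u].

Lemma word_invK : involutive word_inv.
Proof.
move=> u; rewrite /word_inv map_rev revK -map_comp -[RHS]map_id.
by apply: eq_map => -[i b] /=; rewrite negbK.
Qed.

Lemma word_catV u : word_eq r (u ++ word_inv u) [::].
Proof.
elim: u => [|[i b] u IHu]; first exact: WordRefl.
have -> : ((i, b) :: u) ++ word_inv ((i, b) :: u) =
    [:: (i, b)] ++ ((u ++ word_inv u) ++ [:: (i, ~~ b)]).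
  by rewrite /word_inv /= rev_cons -cats1 catA.
apply: WordTrans (WordCancel r i b); rewrite -[[:: (i, b); _]]cat1s.
apply: WordCat (WordRefl _ _) _; rewrite -[X in word_eq r _ X]cat0s.
exact: WordCat IHu (WordRefl _ _).
Qed.

Lemma word_catVw u : word_eq r (word_inv u ++ u) [::].
Proof. by rewrite -{2}[u]word_invK; apply: word_catV. Qed.

Lemma word_inv_eq u v : word_eq r u v -> word_eq r (word_inv u) (word_inv v).
Proof.
move=> uv; apply: (@WordTrans _ _ (word_inv u ++ (v ++ word_inv v))).
  rewrite -[X in word_eq r X _]cats0; apply: WordCat (WordRefl _ _) _.
  exact/WordSym/word_catV.
rewrite -[X in word_eq r _ X]cat0s catA; apply: WordCat (WordRefl _ _).
apply: WordTrans (word_catVw u); apply: WordCat (WordRefl _ _) _.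
exact: WordSym.
Qed.

Definition presented_one : presented := \pi_presented [::].
Definition presented_mul (x y : presented) : presented :=
  \pi_presented (repr x ++ repr y).
Definition presented_inv (x : presented) : presented :=
  \pi_presented (word_inv (repr x)).

Lemma presented_mulE u v :
  presented_mul (\pi_presented u) (\pi_presented v) = \pi_presented (u ++ v).
Proof. by apply/presented_eqP/WordCat; apply: presented_reprP. Qed.

Lemma presented_invE u :
  presented_inv (\pi_presented u) = \pi_presented (word_inv u).
Proof. by apply/presented_eqP/word_inv_eq/presented_reprP. Qed.

Lemma presented_mulA : associative presented_mul.
Proof.
elim/quotW=> u; elim/quotW=> v; elim/quotW=> w.
by rewrite (presented_mulE v w) (presented_mulE u v) !presented_mulE catA.
Qed.

Lemma presented_mul1 : left_id presented_one presented_mul.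
Proof. by elim/quotW=> u; rewrite presented_mulE. Qed.

Lemma presented_mulr1 : right_id presented_one presented_mul.
Proof. by elim/quotW=> u; rewrite presented_mulE cats0. Qed.

Lemma presented_mulV :
  left_inverse presented_one presented_inv presented_mul.
Proof.
elim/quotW=> u; rewrite presented_invE presented_mulE.
exact/presented_eqP/word_catVw.
Qed.

Lemma presented_mulrV :
  right_inverse presented_one presented_inv presented_mul.
Proof.
elim/quotW=> u; rewrite presented_invE presented_mulE.
exact/presented_eqP/word_catV.
Qed.

HB.instance Definition _ := isGroup.Build presented
  presented_mulA presented_mul1 presented_mulr1
  presented_mulV presented_mulrV.

Definition generator (i : I) : presented := \pi_presented [:: (i, true)].

Section Lift.
Variables (G : groupType) (f : I -> G).

Definition word_eval (u : word I) : G :=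
  \prod_(l <- u) (if l.2 then f l.1 else (f l.1)^-1).

(* This is a morphism when [f] satisfies the defining relations. *)
Definition presented_lift (x : presented) : G := word_eval (repr x).

Hypothesis f_rel : forall u v, r u v -> word_eval u = word_eval v.

Lemma word_eval_eq u v : word_eq r u v -> word_eval u = word_eval v.
Proof.
rewrite /word_eval; elim=> {u v} [u v /f_rel //|i b|||u v _ -> //|].
- by rewrite !big_cons !big_nil /= mulg1; case: b; rewrite /= (mulgV, mulVg).
- by move=> u u' v v' _ IHu _ IHv; rewrite !big_cat /= IHu IHv.
- by [].
- by move=> v u w _ -> _ ->.
Qed.

Lemma presented_lift_pi u : presented_lift (\pi_presented u) = word_eval u.
Proof. exact/word_eval_eq/presented_reprP. Qed.

Lemma presented_lift_generator i : presented_lift (generator i) = f i.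
Proof. by rewrite presented_lift_pi /word_eval big_seq1. Qed.

Lemma presented_liftM : {morph presented_lift : x y / x * y}.
Proof.
elim/quotW=> u; elim/quotW=> v.
rewrite [_ * _]presented_mulE !presented_lift_pi.
by rewrite /word_eval big_cat.
Qed.

End Lift.
End Presented.

Definition isomorphic (G H : groupType) : Prop :=
  exists f : {multiplicative G -> H}, bijective f.

HB.mixin Record isConjClosed (G : groupType) (S : {pred G}) := {
  gpredJr : {in S, forall x y, x ^ y \in S}
}.

#[short(type="normalClosed")]
HB.structure Definition NormalClosed (G : groupType) :=
  {S of isConjClosed G S & GroupClosed G S}.

Section QuotientGroup.
Variables (G : groupType) (N : normalClosed G).

Definition coset_eq : rel G := fun x y => x^-1 * y \in N.

Lemma coset_eq_refl : reflexive coset_eq.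
Proof. by move=> x; rewrite /coset_eq mulVg gpred1. Qed.

Lemma coset_eq_sym : symmetric coset_eq.
Proof. by move=> x y; rewrite /coset_eq -gpredV invgM invgK. Qed.

Lemma coset_eq_trans : transitive coset_eq.
Proof.
move=> y x z xy yz; rewrite /coset_eq.
by rewrite -[z](mulVKg y) mulgA gpredM.
Qed.

Canonical coset_equiv := EquivRel coset_eq
  coset_eq_refl coset_eq_sym coset_eq_trans.

Definition quotient_group : Type := {eq_quot coset_equiv}.

HB.instance Definition _ := EqQuotient.on quotient_group.
HB.instance Definition _ := Choice.on quotient_group.

Lemma quotient_eqP x y :
  reflect (\pi_quotient_group x = \pi_quotient_group y) (x^-1 * y \in N).
Proof. exact: (@eqmodP _ coset_equiv). Qed.

Definition quotient_one : quotient_group := \pi_quotient_group 1.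
Definition quotient_mul (a b : quotient_group) : quotient_group :=
  \pi_quotient_group (repr a * repr b).
Definition quotient_inv (a : quotient_group) : quotient_group :=
  \pi_quotient_group (repr a)^-1.

Lemma quotient_mulE x y :
  quotient_mul (\pi_quotient_group x) (\pi_quotient_group y) = \pi_quotient_group (x * y).
Proof.
apply/quotient_eqP; set x' := repr _; set y' := repr _.
have xx : x'^-1 * x \in N by apply/quotient_eqP; rewrite reprK.
have yy : y'^-1 * y \in N by apply/quotient_eqP; rewrite reprK.
have -> : (x' * y')^-1 * (x * y) = (x'^-1 * x) ^ y' * (y'^-1 * y).
  by rewrite conjgE invgM !mulgA mulgK.
by rewrite gpredM ?gpredJr.
Qed.

Lemma quotient_invE x : quotient_inv (\pi_quotient_group x) = \pi_quotient_group x^-1.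
Proof.
apply/quotient_eqP; set x' := repr _.
have xx : x'^-1 * x \in N by apply/quotient_eqP; rewrite reprK.
have -> : x'^-1^-1 * x^-1 = ((x'^-1 * x)^-1) ^ x'^-1.
  by rewrite conjgE !invgM !invgK !mulgA mulgK.
by rewrite gpredJr ?gpredV.
Qed.

Lemma quotient_mulA : associative quotient_mul.
Proof.
elim/quotW=> x; elim/quotW=> y; elim/quotW=> z.
by rewrite (quotient_mulE y z) (quotient_mulE x y) !quotient_mulE mulgA.
Qed.

Lemma quotient_mul1 : left_id quotient_one quotient_mul.
Proof. by elim/quotW=> x; rewrite quotient_mulE mul1g. Qed.

Lemma quotient_mulr1 : right_id quotient_one quotient_mul.
Proof. by elim/quotW=> x; rewrite quotient_mulE mulg1. Qed.

Lemma quotient_mulV : left_inverse quotient_one quotient_inv quotient_mul.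
Proof.
by elim/quotW=> x; rewrite quotient_invE quotient_mulE mulVg.
Qed.

Lemma quotient_mulrV : right_inverse quotient_one quotient_inv quotient_mul.
Proof.
by elim/quotW=> x; rewrite quotient_invE quotient_mulE mulgV.
Qed.

HB.instance Definition _ := isGroup.Build quotient_group
  quotient_mulA quotient_mul1 quotient_mulr1 quotient_mulV quotient_mulrV.

End QuotientGroup.

Section Kernel.
Variables (G H : groupType) (f : {multiplicative G -> H}).

Definition kernel : {pred G} := fun x => f x == 1.

Let f1 : f 1 = 1.
Proof. by apply: (mulgI (f 1)); rewrite -gmulfM !mulg1. Qed.

Lemma kernelM : mulg_closed kernel.
Proof.
move=> x y; rewrite !unfold_in => /eqP fx /eqP fy.
by rewrite gmulfM fx fy mulg1.
Qed.

Lemma kernel1 : 1 \in kernel.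
Proof. by rewrite unfold_in f1. Qed.

Lemma kernelV : invg_closed kernel.
Proof.
move=> x; rewrite !unfold_in => /eqP fx; apply/eqP.
by rewrite -[LHS]mul1g -fx -gmulfM mulgV f1.
Qed.

Lemma kernelJ : {in kernel, forall x y, x ^ y \in kernel}.
Proof.
move=> x; rewrite unfold_in => /eqP fx y; rewrite unfold_in conjgE !gmulfM fx.
by rewrite mul1g -gmulfM mulVg f1.
Qed.

HB.instance Definition _ := isMulClosed.Build G kernel kernelM.
HB.instance Definition _ := isMul1Closed.Build G kernel kernel1.
HB.instance Definition _ := isInvClosed.Build G kernel kernelV.
HB.instance Definition _ := isConjClosed.Build G kernel kernelJ.

End Kernel.

Section Generated.
Variables (G : groupType) (A : G -> Prop).

Definition generated : {pred G} := fun x =>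
  `[< forall S : groupClosed G, (forall a, A a -> a \in S) -> x \in S >].

Lemma generatedP x :
  reflect (forall S : groupClosed G, (forall a, A a -> a \in S) -> x \in S)
          (x \in generated).
Proof. by rewrite unfold_in; apply: asboolP. Qed.

Lemma generatedM : mulg_closed generated.
Proof.
move=> x y /generatedP Ax /generatedP Ay; apply/generatedP => S AS.
by rewrite gpredM ?Ax ?Ay.
Qed.

Lemma generated1 : 1 \in generated.
Proof. by apply/generatedP => S _; rewrite gpred1. Qed.

Lemma generatedV : invg_closed generated.
Proof.
by move=> x /generatedP Ax; apply/generatedP => S AS; rewrite gpredV Ax.
Qed.

HB.instance Definition _ := isMulClosed.Build G generated generatedM.
HB.instance Definition _ := isMul1Closed.Build G generated generated1.
HB.instance Definition _ := isInvClosed.Build G generated generatedV.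

End Generated.

Section ConjPreimage.
Variables (G : groupType) (S : groupClosed G) (z : G).

Definition conj_preimage : {pred G} := fun x => x ^ z \in S.

Lemma in_conj_preimage x : (x \in conj_preimage) = (x ^ z \in S).
Proof. by []. Qed.

Lemma conj_preimageM : mulg_closed conj_preimage.
Proof. by move=> x y; rewrite !in_conj_preimage conjMg; apply: gpredM. Qed.

Lemma conj_preimage1 : 1 \in conj_preimage.
Proof. by rewrite in_conj_preimage conj1g gpred1. Qed.

Lemma conj_preimageV : invg_closed conj_preimage.
Proof. by move=> x; rewrite !in_conj_preimage conjVg gpredV. Qed.

HB.instance Definition _ := isMulClosed.Build G conj_preimage conj_preimageM.
HB.instance Definition _ := isMul1Closed.Build G conj_preimage conj_preimage1.
HB.instance Definition _ := isInvClosed.Build G conj_preimage conj_preimageV.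

End ConjPreimage.

Section Derived.
Variables (G : groupType) (N : normalClosed G).

(* [N, N] as a subgroup of the ambient group G; N is required to be normal so
   that the result is again normal in G. *)
Definition derived : {pred G} :=
  generated (fun c => exists x y, [/\ x \in N, y \in N & c = [~ x, y]]).

HB.instance Definition _ := GroupClosed.on derived.

Lemma derivedJ : {in derived, forall x y, x ^ y \in derived}.
Proof.
move=> x /generatedP Ax z; apply/generatedP => S AS.
rewrite -in_conj_preimage; apply: Ax => _ [a [b [aN bN ->]]].
rewrite in_conj_preimage; apply: AS; exists (a ^ z), (b ^ z).
by rewrite !gpredJr // conjRg.
Qed.

HB.instance Definition _ := isConjClosed.Build G derived derivedJ.

End Derived.

Section Braid.
Variable n : nat.

(* The index i : 'I_n.-1 is 0-based: it stands for the (i+1)-st generator. *)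
Local Notation s i := (i, true).
Local Notation sV i := (i, false).

Inductive braid_rel : word 'I_n.-1 -> word 'I_n.-1 -> Prop :=
  | BraidComm (i j : 'I_n.-1) of (i.+2 <= j) || (j.+2 <= i) :
      braid_rel [:: s i; s j] [:: s j; s i]
  | BraidBraid (i j : 'I_n.-1) of j = i.+1 :> nat :
      braid_rel [:: s i; s j; s i] [:: s j; s i; s j].

Inductive pseudosym_rel : word 'I_n.-1 -> word 'I_n.-1 -> Prop :=
  | PseudosymBraid u v of braid_rel u v : pseudosym_rel u v
  | PseudosymMixed (i j : 'I_n.-1) of j = i.+1 :> nat :
      pseudosym_rel [:: s i; sV j; s i] [:: s j; sV i; s j].

Definition braid_group : groupType := presented braid_rel.
Definition pseudosym_group : groupType := presented pseudosym_rel.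

Lemma adj_lt1 (i : 'I_n.-1) : i < n.
Proof. by rewrite ltnW // -ltn_predRL. Qed.

Lemma adj_lt2 (i : 'I_n.-1) : i.+1 < n.
Proof. by rewrite -ltn_predRL. Qed.

Definition adj_tperm (i : 'I_n.-1) : 'S_n :=
  tperm (Ordinal (adj_lt1 i)) (Ordinal (adj_lt2 i)).

Lemma adj_tperm_rel u v :
  braid_rel u v -> word_eval adj_tperm u = word_eval adj_tperm v.
Proof.
have sJs i j : adj_tperm i * (adj_tperm j * adj_tperm i)
             = adj_tperm j ^ adj_tperm i by rewrite conjgE /adj_tperm tpermV.
rewrite /word_eval; case=> {u v} i j ij; rewrite !big_cons !big_nil !mulg1 /=.
  rewrite conjgC; congr (_ * _); rewrite /adj_tperm tpermJ.
  by rewrite !tpermD // -val_eqE /=; case/orP: ij => ij; lia.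
rewrite !sJs /adj_tperm !tpermJ.
have -> : Ordinal (adj_lt1 j) = Ordinal (adj_lt2 i) by apply: val_inj.
by rewrite tpermR tpermL !tpermD // -val_eqE /=; lia.
Qed.

Definition braid_perm : braid_group -> 'S_n := presented_lift adj_tperm.

HB.instance Definition _ := isMultiplicative.Build braid_group 'S_n braid_perm
  (presented_liftM adj_tperm_rel).

Lemma braid_perm_generator i : braid_perm (generator _ i) = adj_tperm i.
Proof. exact: (presented_lift_generator adj_tperm_rel). Qed.

Definition pure_braid : {pred braid_group} := kernel braid_perm.

HB.instance Definition _ := NormalClosed.on pure_braid.

End Braid.

Arguments pure_braid n : clear implicits.

(* Main.v *)
From HB Require Import structures.
From mathcomp Require Import perm boolp zify all_boot.
Require Import Defs.

(** The natural map from the pseudosymmetric group to B_n/P_n' sends generators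
    to generators. It exists because each square s_i^2 is a pure braid, so
    neighbouring squares commute modulo P_n', and for a braided pair of
    elements the mixed relation x y^-1 x = y x^-1 y says exactly that x^2 and
    y^2 commute ([braid_mixedP]).

    Its inverse is induced by the projection of B_n onto the pseudosymmetric
    group, provided that the projection kills P_n'. Since pure braids land in
    the kernel of the map to S_n, it is enough that this kernel is abelian
    ([pseudosym_ker_commute]), and two facts give this.

    - The kernel is the normal closure of the squares s_i^2. This is the
      faithfulness of the Coxeter presentation of S_n; it is proved by writing
      every element, modulo that normal closure, as an element of the
      subgroup of s_0, ..., s_(r-1) times a descending product
      s_r s_(r-1) ... s_k, and following the last point ([coxeter_ker]).

    - The conjugates of the squares commute with each other. In the
      pseudosymmetric group the standard pure braid generators A_ij, here
      called bands, are permuted by conjugation by s_k exactly as the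
      transposition s_k permutes the pairs {i, j} ([band_conj]). So they are
      all the conjugates of the squares, and, as s_k acts as an involution,
      s_k^2 centralizes every one of them ([sq_conjs_commute]). *)

Set Implicit Arguments.
Unset Strict Implicit.
Unset Printing Implicit Defensive.

Local Open Scope quotient_scope.
Local Open Scope group_scope.

(** * Groups, morphisms and braided pairs *)

Lemma gmorph1 (G H : groupType) (f : {multiplicative G -> H}) : f 1 = 1.
Proof. by apply: (mulgI (f 1)); rewrite -gmulfM !mulg1. Qed.

Lemma gmorphV (G H : groupType) (f : {multiplicative G -> H}) x :
  f x^-1 = (f x)^-1.
Proof. by apply: (mulgI (f x)); rewrite -gmulfM !mulgV gmorph1. Qed.

Lemma commute_conjg (G : groupType) (x y : G) : commute x y -> x ^ y = x.
Proof. by move=> xy; rewrite conjgE xy mulKg. Qed.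

Lemma braid_conjg (G : groupType) (x y : G) :
  x * y * x = y * x * y -> x ^ (y * x) = y.
Proof.
by move=> xy; apply: (mulgI (y * x)); rewrite -conjgC mulgA xy.
Qed.

(** Multiply the two sides of the mixed relation on the right by the two sides
    of the braid relation: since x^2 = (y^2)^(x y) and y^2 = (x^2)^(y x), the
    products simplify to x^2 y^2 and y^2 x^2. *)
Lemma braid_mixedP (G : groupType) (x y : G) : x * y * x = y * x * y ->
  x * y^-1 * x = y * x^-1 * y <-> commute (x ^+ 2) (y ^+ 2).
Proof.
move=> xy.
have xxyy : x * y^-1 * x * (x * y * x) = x ^+ 2 * y ^+ 2.
  have /(congr1 (fun z => z ^+ 2)) := braid_conjg xy.
  rewrite -conjXg !expg2 conjgE invgM => <-.
  by rewrite !gnorm.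
have yyxx : y * x^-1 * y * (y * x * y) = y ^+ 2 * x ^+ 2.
  have /(congr1 (fun z => z ^+ 2)) := braid_conjg (esym xy).
  rewrite -conjXg !expg2 conjgE invgM => <-.
  by rewrite !gnorm.
rewrite /commute -xxyy -yyxx -xy; split=> [-> //|]; exact: mulIg.
Qed.

(** * Conjugates of the squares *)

Section Bands.

Variables (G : groupType) (m : nat) (t : nat -> G).
Hypothesis tC : forall i j, i.+1 < j -> j < m -> commute (t i) (t j).
Hypothesis tB : forall i, i.+1 < m ->
  t i * t i.+1 * t i = t i.+1 * t i * t i.+1.
Hypothesis tS : forall i, i.+1 < m -> commute (t i ^+ 2) (t i.+1 ^+ 2).

(** The pure braid generator A_(i, i+d+1), in which the strands i and i+d+1
    make one full twist. *)
Fixpoint band i d : G :=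
  if d is d'.+1 then band i d' ^ t (i + d) else t i ^+ 2.

Lemma band_far k i d : k < m -> i + d < m -> (k.+1 < i) || ((i + d).+1 < k) ->
  band i d ^ t k = band i d.
Proof.
have tCs j l : j < m -> l < m -> (j.+1 < l) || (l.+1 < j) -> commute (t j) (t l).
  by move=> jm lm /orP[] jl; [|apply: commute_sym]; apply: tC.
move=> km; elim: d => [|d IHd] dm ki /=.
  by rewrite conjXg (commute_conjg (tCs _ _ _ _ _)) //; lia.
by rewrite -conjgM tCs ?conjgM ?IHd //; lia.
Qed.

(** Conjugating further by t_(i+1) turns both sides into t_i^2: the left one by
    the braid relation, the right one because neighbouring squares commute. *)
Lemma sq_conj_next i : i.+1 < m -> (t i.+1 ^+ 2) ^ t i = band i 1.
Proof.
move=> im; rewrite /= addn1; apply: (@conjg_inj _ (t i.+1)).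
rewrite -!conjgM conjXg (braid_conjg (esym (tB im))) -expg2.
by rewrite (commute_conjg (tS im)).
Qed.

Lemma band_left i d : i.+1 + d < m -> band i.+1 d ^ t i = band i d.+1.
Proof.
elim: d => [|d IHd] dm; first by rewrite sq_conj_next //; lia.
rewrite [LHS]/= -conjgM -tC; [|lia|lia].
by rewrite conjgM IHd /= -?addSnnS //; lia.
Qed.

Lemma band_leftV i d : i + d.+1 < m -> band i d.+1 ^ t i = band i.+1 d.
Proof.
elim: d => [|d IHd] dm.
  by rewrite /= addn1 -conjgM conjXg braid_conjg //; apply: tB; lia.
rewrite [LHS]/= -conjgM -tC; [|lia|lia].
rewrite conjgM -[X in X ^ t i]/(band i d.+1) IHd; last lia.
by rewrite /= addSnnS.
Qed.

Lemma band_right i d : band i d ^ t (i + d).+1 = band i d.+1.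
Proof. by rewrite /= addnS. Qed.

(** This says that the band commutes with the square of the letter just to
    its right. Conjugated by t_(p+1) t_p, the same statement for the next
    shorter band gives the one for this band, since t_(p+1) fixes the shorter
    band and the braid relation sends t_p to t_(p+1). *)
Lemma band_rightV i d : (i + d).+1 < m ->
  band i d.+1 ^ t (i + d).+1 = band i d.
Proof.
move=> dm; rewrite /= addnS -conjgM -expg2; apply: commute_conjg.
elim: d dm => [|d IHd] dm; first by rewrite addn0 in dm *; apply: tS.
set p := (i + d).+1; have -> : i + d.+1 = p by rewrite addnS.
have pm : p.+1 < m by lia.
rewrite /= addnS -/p.
have fixed : band i d ^ t p.+1 = band i d by apply: band_far; lia.
have: commute ((band i d ^ t p.+1) ^ t p) (((t p ^+ 2) ^ t p.+1) ^ t p).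
  by rewrite /commute -!conjMg IHd //; lia.
by rewrite fixed -conjgM conjXg (braid_conjg (tB pm)).
Qed.

(** When k is the last inner letter, the band is a shorter one, fixed by
    t_(k+1), conjugated by t_k t_(k+1); the braid relation moves a further t_k
    to the front, where it becomes a t_(k+1) and is absorbed. *)
Lemma band_inner i d k : i < k < i + d -> i + d < m -> band i d ^ t k = band i d.
Proof.
elim: d => [|d IHd]; first lia.
move=> ik dm; have [kd|kd] := eqVneq k (i + d); last first.
  by rewrite /= -conjgM -tC ?conjgM ?IHd //; lia.
case: d => [|d] in IHd dm ik kd *; first lia.
have [{}kd km] : i + d.+1 = k /\ i + d.+2 = k.+1 by lia.
rewrite /= kd km -!conjgM ?mulgA tB; last lia.
by rewrite -mulgA [LHS]conjgM (@band_far k.+1) //; lia.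
Qed.

(** Conjugation by t_k acts on the bands as the transposition (k, k+1) acts on
    pairs of points. Only two consequences are recorded: the image is a band,
    and conjugating twice is the identity. *)
Lemma band_conj i d k : i + d < m -> k < m -> exists j e,
  [/\ j + e < m, band i d ^ t k = band j e & band j e ^ t k = band i d].
Proof.
move=> dm km; have [kl|kr] := ltnP k i.
  have [ik|ki] := ltnP k.+1 i; first by exists i, d; rewrite band_far ?ik.
  have {ki kl} ik : i = k.+1 by lia.
  exists k, d.+1; subst i.
  by split; [lia | apply: band_left; lia | apply: band_leftV; lia].
have [kd|dk] := ltnP k (i + d); last first.
  have [ik|ki] := ltnP (i + d).+1 k.
    by exists i, d; rewrite band_far ?orbT //; lia.
  have [kd|kd] : k = (i + d).+1 \/ k = i + d by lia.
    exists i, d.+1; subst k.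
    by split; [lia | apply: band_right | apply: band_rightV; lia].
  case: d => [|d] in dm kd dk ki *; subst k.
    have ti: (t i ^+ 2) ^ t i = t i ^+ 2.
      by apply: commute_conjg; apply: commute_sym; apply: commuteX.
    by exists i, 0; rewrite addn0 in dm *.
  exists i, d; rewrite addnS.
  by split; [lia | apply: band_rightV; lia | apply: band_right].
have [ik|ik] := eqVneq i k; last by exists i, d; rewrite band_inner //; lia.
subst k; case: d => [|d] in dm kd *; first lia.
exists i.+1, d.
by split; [lia | apply: band_leftV; lia | apply: band_left; lia].
Qed.

Lemma band_conj_sq i d k : i + d < m -> k < m ->
  commute (band i d) (t k ^+ 2).
Proof.
move=> dm /(band_conj dm)[j [e [_ ij ji]]]; apply/commgP.
by apply/conjg_fixP; rewrite expg2 conjgM ij.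
Qed.

Definition is_band y := exists i d, i + d < m /\ y = band i d.

Lemma is_bandJ k y : k < m -> is_band y -> is_band (y ^ t k).
Proof.
by move=> km [i [d [dm ->]]]; have [j [e [em -> _]]] := band_conj dm km; exists j, e.
Qed.

Lemma is_bandJV k y : k < m -> is_band y -> is_band (y ^ (t k)^-1).
Proof.
move=> km [i [d [dm ->]]]; have [j [e [em _ <-]]] := band_conj dm km.
by exists j, e; rewrite conjgK.
Qed.

(* The t_k generate G, in the form of an induction principle. *)
Hypothesis t_ind : forall P : G -> Prop, P 1 ->
  (forall x k, k < m -> P x -> P (x * t k)) ->
  (forall x k, k < m -> P x -> P (x * (t k)^-1)) -> forall x, P x.

(** Undoing the conjugation of one of the two squares leaves a plain square
    t_l^2 and a conjugate of t_k^2, which is a band. *)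
Lemma sq_conjs_commute k l x y : k < m -> l < m ->
  commute ((t k ^+ 2) ^ x) ((t l ^+ 2) ^ y).
Proof.
move=> km lm.
suff [i [d [dm xy]]] : is_band ((t k ^+ 2) ^ (x * y^-1)).
  have := band_conj_sq dm lm; rewrite -xy => /(congr1 (conjg^~ y)).
  by rewrite /= (conjMg _ (t l ^+ 2)) (conjMg (t l ^+ 2)) -conjgM mulgVK.
have: is_band (t k ^+ 2) by exists k, 0; rewrite addn0.
elim/t_ind: (_ * _) => [|z j jm IHz|z j jm IHz] kb; first by rewrite conjg1.
  by rewrite conjgM; apply: is_bandJ (IHz kb).
by rewrite conjgM; apply: is_bandJV (IHz kb).
Qed.

End Bands.

(** * The Coxeter presentation of the symmetric group *)

Section Coxeter.

Variables (G : groupType) (N : normalClosed G) (m : nat) (t : nat -> G).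
Variable p : {multiplicative G -> 'S_m.+1}.
Hypothesis tC : forall i j, i.+1 < j -> j < m -> commute (t i) (t j).
Hypothesis tB : forall i, i.+1 < m ->
  t i * t i.+1 * t i = t i.+1 * t i * t i.+1.
Hypothesis tN : forall i, i < m -> t i ^+ 2 \in N.
Hypothesis pN : forall x, x \in N -> p x = 1.
Hypothesis pt : forall i, i < m -> p (t i) = tperm (inord i) (inord i.+1).

(** The subgroup generated by N and t_0, ..., t_(r-1). Inverse letters are not
    needed as constructors, because t_k^-1 is t_k up to a square, which is in
    N. *)
Inductive parabolic r : G -> Prop :=
  | ParabolicN c of c \in N : parabolic r c
  | ParabolicMul x k of parabolic r x & k < r : parabolic r (x * t k).

Lemma parabolicMN r x c : parabolic r x -> c \in N -> parabolic r (x * c).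
Proof.
move=> rx; elim: rx c => [a aN|{}x k rx IHx kr] c cN.
  by apply: ParabolicN; rewrite gpredM.
rewrite -mulgA (conjgCV (t k)) mulgA; apply: ParabolicMul => //.
by apply: IHx; apply: gpredJr.
Qed.

(** A lift of the cycle that sends the point k+e to k and shifts the points
    from k to k+e-1 up by one: a shortest representative of a coset of the
    parabolic subgroup of rank k+e-1. *)
Fixpoint descent k e : G :=
  if e is e'.+1 then t (k + e') * descent k e' else 1.

Lemma descentSr k e : descent k e.+1 = descent k.+1 e * t k.
Proof.
elim: e => [|e IHe]; first by rewrite /= addn0 mulg1 mul1g.
by rewrite -[LHS]/(t _ * descent k e.+1) IHe /= mulgA addSnnS.
Qed.

Lemma descent_far i k e : i < m -> k + e <= m ->
  (i.+1 < k) || (k + e < i) -> commute (t i) (descent k e).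
Proof.
move=> im; elim: e => [|e IHe] em ik; first exact: commute1.
apply: commuteM; last by apply: IHe; lia.
by case/orP: ik => ik; [|apply: commute_sym]; apply: tC; lia.
Qed.

Lemma descent_shift i k e : k <= i -> i.+1 < k + e -> k + e <= m ->
  descent k e * t i.+1 = t i * descent k e.
Proof.
move=> ki; elim: e => [|e IHe] ie em; first lia.
have [{}ie|ei] := ltnP i.+1 (k + e).
  rewrite /= -mulgA IHe; [|lia|lia].
  by rewrite mulgA -tC; [rewrite mulgA|lia|lia].
case: e => [|e] in IHe ie em ei *; first lia.
have [{}ei ei1] : k + e = i /\ k + e.+1 = i.+1 by lia.
rewrite /= ei ei1 -!mulgA -descent_far; [|lia|lia|lia].
by rewrite !mulgA tB //; lia.
Qed.

(** The descending products ending in t_k, for k = 0, ..., r+1 (the empty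
    product for k = r+1), represent all cosets of the smaller parabolic
    subgroup: multiplying one of them by a letter t_j extends it (j = k-1),
    shortens it up to a square (j = k), or moves the letter to the front as
    t_j or t_(j-1), inside the smaller subgroup. *)
Lemma parabolic_factor r x : r < m -> parabolic r.+1 x ->
  exists h k e, [/\ parabolic r h, k + e = r.+1 & x = h * descent k e].
Proof.
move=> rm; elim=> [c cN|{}x j _ [h [k [e [rh ke ->]]]] jr].
  by exists c, r.+1, 0; rewrite addn0 mulg1; split=> //; apply: ParabolicN.
have [jk|kj] := ltnP j k.
  have [kj|jk'] := ltnP j.+1 k.
    exists (h * t j), k, e; split=> //; first by apply: ParabolicMul => //; lia.
    by rewrite -!mulgA (descent_far _ _ (k := k)) //; lia.
  have {jk jk'} kj : k = j.+1 by lia.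
  exists h, j, e.+1; rewrite addnS -addSn -kj; split=> //.
  by rewrite descentSr -mulgA kj.
have [jk|jk] := eqVneq j k; last first.
  have [i ij] : exists i, j = i.+1 by exists j.-1; lia.
  exists (h * t i), k, e; split=> //; first by apply: ParabolicMul => //; lia.
  by rewrite ij -!mulgA descent_shift //; lia.
subst j; case: e => [|e] in ke *; first lia.
exists (h * (t k ^+ 2) ^ (descent k.+1 e)^-1), k.+1, e; split; last 1 first.
- by rewrite descentSr expg2 -[RHS]mulgA -conjgCV !mulgA.
- by apply: parabolicMN => //; apply: gpredJr; apply: tN; lia.
- by rewrite addSnnS.
Qed.

Lemma parabolic_fix r h : r < m -> parabolic r h ->
  p h (inord r.+1) = inord r.+1.
Proof.
move=> rm; elim=> [c /pN->|{}h k _ IHh kr]; first by rewrite perm1.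
rewrite gmulfM permM IHh pt ?tpermD //; try lia.
  by rewrite -val_eqE /= !inordK; lia.
by rewrite -val_eqE /= !inordK; lia.
Qed.

Lemma descent_perm k e : k + e <= m ->
  p (descent k e) (inord (k + e)) = inord k.
Proof.
elim: e => [|e IHe] em; first by rewrite addn0 gmorph1 perm1.
by rewrite /= gmulfM permM pt ?addnS ?tpermR ?IHe //; lia.
Qed.

(** The last point r+1 is fixed by the smaller parabolic factor and sent to k by
    the descending product, so that product is empty. *)
Lemma parabolic_ker r x : r <= m -> parabolic r x -> p x = 1 -> x \in N.
Proof.
elim: r x => [|r IHr] x rm rx px; first by case: rx.
have [h [k [[|e] [rh ke xE]]]] := parabolic_factor rm rx; subst x.
  by rewrite mulg1 in px *; apply: IHr => //; lia.
have: p (h * descent k e.+1) (inord r.+1) = inord r.+1 by rewrite px perm1.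
rewrite gmulfM permM parabolic_fix // -ke descent_perm; last lia.
by move/(congr1 val); rewrite /= !inordK; lia.
Qed.

Hypothesis t_ind : forall P : G -> Prop, P 1 ->
  (forall x k, k < m -> P x -> P (x * t k)) ->
  (forall x k, k < m -> P x -> P (x * (t k)^-1)) -> forall x, P x.

(** For G presented by the braid relations and N the normal closure of the
    squares, this is the faithfulness of the Coxeter presentation. *)
Lemma coxeter_ker x : p x = 1 -> x \in N.
Proof.
apply: (parabolic_ker (leqnn m)).
elim/t_ind: x => [|x k km mx|x k km mx].
- by apply: ParabolicN; apply: gpred1.
- exact: ParabolicMul.
have -> : (t k)^-1 = t k * (t k ^+ 2)^-1 by rewrite expg2 invgM mulVKg.
by rewrite mulgA; apply: parabolicMN; [apply: ParabolicMul|rewrite gpredV tN].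
Qed.

End Coxeter.

(** * Commutants and normal closures *)

Section Commutant.

Variables (G : groupType) (A : G -> Prop).

Definition commutant : {pred G} := fun x => `[< forall a, A a -> commute a x >].

Lemma commutantP x : reflect (forall a, A a -> commute a x) (x \in commutant).
Proof. by rewrite unfold_in; apply: asboolP. Qed.

Lemma commutantM : mulg_closed commutant.
Proof.
move=> x y /commutantP xA /commutantP yA; apply/commutantP => a Aa.
by apply: commuteM; [apply: xA|apply: yA].
Qed.

Lemma commutant1 : 1 \in commutant.
Proof. by apply/commutantP => a _; apply: commute1. Qed.

Lemma commutantV : invg_closed commutant.
Proof.
by move=> x /commutantP xA; apply/commutantP => a Aa; apply/commuteV/xA.
Qed.

HB.instance Definition _ := isMulClosed.Build G commutant commutantM.
HB.instance Definition _ := isMul1Closed.Build G commutant commutant1.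
HB.instance Definition _ := isInvClosed.Build G commutant commutantV.

End Commutant.

(** Commutants are subgroups, so commuting passes from the generators to the
    group they generate, one argument at a time. *)
Lemma generated_commute (G : groupType) (A : G -> Prop) :
  (forall a b, A a -> A b -> commute a b) ->
  {in generated A &, forall x y, commute x y}.
Proof.
move=> AA x y /generatedP Ax /generatedP Ay.
suff /commutantP: y \in commutant (fun z => z = x) by apply.
apply: Ay => b Ab; apply/commutantP => _ ->; apply: commute_sym.
suff /commutantP: x \in commutant (fun z => z = b) by apply.
by apply: Ax => a Aa; apply/commutantP => _ ->; apply: AA.
Qed.

Section NormalClosure.

Variables (G : groupType) (A : G -> Prop).

Definition normal_closure : {pred G} :=
  generated (fun y => exists a x, A a /\ y = a ^ x).

HB.instance Definition _ := GroupClosed.on normal_closure.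

Lemma normal_closureJ : {in normal_closure, forall x y, x ^ y \in normal_closure}.
Proof.
move=> x /generatedP Ax z; apply/generatedP => S AS.
rewrite -in_conj_preimage; apply: Ax => _ [a [b [Aa ->]]].
by rewrite in_conj_preimage -conjgM; apply: AS; exists a, (b * z).
Qed.

HB.instance Definition _ := isConjClosed.Build G normal_closure normal_closureJ.

Lemma normal_closure_gen a : A a -> a \in normal_closure.
Proof. by move=> Aa; apply/generatedP => S; apply; exists a, 1; rewrite conjg1. Qed.

Lemma normal_closure_sub (S : normalClosed G) :
  (forall a, A a -> a \in S) -> {subset normal_closure <= S}.
Proof.
move=> AS x /generatedP; apply=> _ [a [b [Aa ->]]].
by apply: gpredJr; apply: AS.
Qed.

End NormalClosure.

(** * Presented groups and quotient maps *)

Section Presented.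

Variables (I : choiceType) (r : word I -> word I -> Prop).

Lemma generatorV i : (generator r i)^-1 = \pi_(presented r) [:: (i, false)].
Proof. exact: presented_invE. Qed.

Lemma presented_ind (P : presented r -> Prop) : P 1 ->
  (forall x i, P x -> P (x * generator r i)) ->
  (forall x i, P x -> P (x * (generator r i)^-1)) -> forall x, P x.
Proof.
move=> P1 Pg PgV; elim/quotW; elim/last_ind => [//|u [i b] IHu].
rewrite -cats1 -presented_mulE; case: b; first exact: Pg.
by rewrite -generatorV; apply: PgV.
Qed.

Lemma word_eval_generator u : word_eval (generator r) u = \pi_(presented r) u.
Proof.
elim: u => [|[i b] u IHu]; first by rewrite /word_eval big_nil.
rewrite /word_eval big_cons [X in _ * X]IHu -[(i, b) :: u]cat1s -presented_mulE.
by case: b; rewrite //= generatorV.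
Qed.

Lemma word_eval_presented u v : r u v ->
  word_eval (generator r) u = word_eval (generator r) v.
Proof. by move=> uv; rewrite !word_eval_generator; apply/presented_eqP/WordRel. Qed.

Lemma gmorph_word_eval (G H : groupType) (f : {multiplicative G -> H})
    (g : I -> G) (u : word I) :
  f (word_eval g u) = word_eval (f \o g) u.
Proof.
rewrite /word_eval; elim: u => [|[i b] u IHu]; first by rewrite !big_nil gmorph1.
by rewrite !big_cons gmulfM IHu; case: b; rewrite //= gmorphV.
Qed.

End Presented.

Section QuotientMap.

Variables (G : groupType) (N : normalClosed G).

Definition quotient_map (x : G) : quotient_group N := \pi_(quotient_group N) x.

Lemma quotient_mapM : {morph quotient_map : x y / x * y}.
Proof. by move=> x y; rewrite [RHS]quotient_mulE. Qed.

HB.instance Definition _ :=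
  isMultiplicative.Build G (quotient_group N) quotient_map quotient_mapM.

End QuotientMap.

Lemma quotient_derived_commute (G : groupType) (N : normalClosed G) x y :
  x \in N -> y \in N ->
  commute (quotient_map (derived N) x) (quotient_map (derived N) y).
Proof.
move=> xN yN; rewrite /commute -!quotient_mapM; apply/quotient_eqP.
apply/generatedP => S; apply; exists y, x; split=> //.
by rewrite commgEl conjgE invgM !mulgA.
Qed.

(** * Families satisfying the braid and pseudosymmetric relations *)

Section Families.

Variables (n : nat) (G : groupType) (f : 'I_n.-1 -> G).

Definition braid_family :=
  (forall i j : 'I_n.-1, i.+2 <= j -> commute (f i) (f j)) /\
  (forall i j : 'I_n.-1, j = i.+1 :> nat -> f i * f j * f i = f j * f i * f j).

Lemma braid_familyP : braid_family <->
  forall u v, braid_rel u v -> word_eval f u = word_eval f v.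
Proof.
split=> [[fC fB] u v [] i j ij|fr].
- rewrite /word_eval !big_cons big_nil /= !mulg1.
  by case/orP: ij => ij; [|symmetry]; apply: fC.
- by rewrite /word_eval !big_cons big_nil /= !mulg1 !mulgA fB.
split=> i j ij.
  have /fr: braid_rel [:: (i, true); (j, true)] [:: (j, true); (i, true)].
    by apply: BraidComm; rewrite ij.
  by rewrite /word_eval !big_cons big_nil /= !mulg1.
have /fr := BraidBraid ij.
by rewrite /word_eval !big_cons big_nil /= !mulg1 !mulgA.
Qed.

Lemma pseudosym_familyP :
  (braid_family /\ forall i j : 'I_n.-1, j = i.+1 :> nat ->
     commute (f i ^+ 2) (f j ^+ 2)) <->
  forall u v, pseudosym_rel u v -> word_eval f u = word_eval f v.
Proof.
split=> [[fB fS] u v []|fr].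
- exact: (braid_familyP.1 fB).
- move=> i j ij; rewrite /word_eval !big_cons big_nil /= !mulg1 !mulgA.
  by apply/(braid_mixedP (fB.2 i j ij)); apply: fS.
have fB: braid_family by apply/braid_familyP => u v /PseudosymBraid/fr.
split=> // i j ij; apply/(braid_mixedP (fB.2 i j ij)).
have /fr := PseudosymMixed ij.
by rewrite /word_eval !big_cons big_nil /= !mulg1 !mulgA.
Qed.

End Families.

(** * The pseudosymmetric group *)

Section Pseudosymmetric.

Variable n : nat.
Notation PS := (pseudosym_group n).
Notation B := (braid_group n).
Notation psgen := (generator (@pseudosym_rel n)).

Lemma psgen_rel :
  braid_family psgen /\ forall i j : 'I_n.-1, j = i.+1 :> nat ->
    commute (psgen i ^+ 2) (psgen j ^+ 2).
Proof. by apply/pseudosym_familyP/word_eval_presented. Qed.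

Lemma adj_tperm_pseudosym u v : pseudosym_rel u v ->
  word_eval (@adj_tperm n) u = word_eval (@adj_tperm n) v.
Proof.
move: u v; apply/pseudosym_familyP; split; first exact/braid_familyP/adj_tperm_rel.
by move=> i j _; rewrite !expg2 !tperm2.
Qed.

Definition pseudosym_perm : PS -> 'S_n := presented_lift (@adj_tperm n).

HB.instance Definition _ := isMultiplicative.Build PS 'S_n pseudosym_perm
  (presented_liftM adj_tperm_pseudosym).

Definition braid_pseudosym : B -> PS := presented_lift psgen.

Lemma psgen_braid u v : braid_rel u v -> word_eval psgen u = word_eval psgen v.
Proof. by move: u v; apply/braid_familyP; case: psgen_rel. Qed.

HB.instance Definition _ := isMultiplicative.Build B PS braid_pseudosym
  (presented_liftM psgen_braid).

Lemma braid_pseudosym_pi u :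
  braid_pseudosym (\pi_(presented (@braid_rel n)) u) =
  \pi_(presented (@pseudosym_rel n)) u.
Proof. by rewrite [LHS](presented_lift_pi psgen_braid) word_eval_generator. Qed.

Lemma pseudosym_perm_braid x : pseudosym_perm (braid_pseudosym x) = braid_perm x.
Proof.
elim/quotW: x => u; rewrite braid_pseudosym_pi.
by rewrite [LHS](presented_lift_pi adj_tperm_pseudosym)
  [RHS](presented_lift_pi (@adj_tperm_rel n)).
Qed.

End Pseudosymmetric.

(** The kernel is contained in the normal closure of the squares, whose
    generators commute pairwise. *)
Lemma pseudosym_ker_commute q (x y : pseudosym_group q.+3) :
  pseudosym_perm x = 1 -> pseudosym_perm y = 1 -> commute x y.
Proof.
pose t k := generator (@pseudosym_rel q.+3) (inord k).
have [[psC psB] psS] := psgen_rel q.+3.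
have tC i j : i.+1 < j -> j < q.+2 -> commute (t i) (t j).
  by move=> ij jq; apply: psC; rewrite !inordK //; lia.
have tB i : i.+1 < q.+2 -> t i * t i.+1 * t i = t i.+1 * t i * t i.+1.
  by move=> iq; apply: psB; rewrite !inordK //; lia.
have tS i : i.+1 < q.+2 -> commute (t i ^+ 2) (t i.+1 ^+ 2).
  by move=> iq; apply: psS; rewrite !inordK //; lia.
have t_ind (P : pseudosym_group q.+3 -> Prop) : P 1 ->
  (forall z k, k < q.+2 -> P z -> P (z * t k)) ->
  (forall z k, k < q.+2 -> P z -> P (z * (t k)^-1)) -> forall z, P z.
  move=> P1 Pt PtV; apply: presented_ind => // z i Pz.
    by rewrite -[i]inord_val; apply: Pt.
  by rewrite -[i]inord_val; apply: PtV.
pose square a := exists2 k, k < q.+2 & a = t k ^+ 2.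
have pt i : i < q.+2 -> pseudosym_perm (t i) = tperm (inord i) (inord i.+1).
  move=> iq; rewrite [LHS](presented_lift_generator (@adj_tperm_pseudosym _)).
  by congr tperm; apply: val_inj; rewrite /= !inordK //; lia.
have ker_sub z : pseudosym_perm z = 1 -> z \in normal_closure square.
  apply: (coxeter_ker tC tB _ _ pt t_ind).
    by move=> i iq; apply: normal_closure_gen; exists i.
  move=> {}z /(normal_closure_sub (S := kernel (@pseudosym_perm q.+3))) zK.
  apply/eqP/zK => _ [k kq ->]; rewrite unfold_in.
  by rewrite expg2 gmulfM /= pt // tperm2.
move=> /ker_sub xN /ker_sub yN; apply: generated_commute xN yN.
move=> _ _ [_ [a [[k kq ->] ->]]] [_ [b [[l lq ->] ->]]].
exact: (sq_conjs_commute tC tB tS t_ind a b kq lq).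
Qed.

Lemma braid_pseudosym_derived q :
  {subset derived (pure_braid q.+3) <= kernel (@braid_pseudosym q.+3)}.
Proof.
move=> z /generatedP; apply=> _ [x [y [xP yP ->]]].
have ker_perm w : w \in pure_braid q.+3 -> pseudosym_perm (braid_pseudosym w) = 1.
  by rewrite pseudosym_perm_braid => /eqP.
rewrite unfold_in commgEl conjgE !gmulfM !gmorphV.
by rewrite -(pseudosym_ker_commute (ker_perm _ yP) (ker_perm _ xP)) mulKg mulVg.
Qed.

(** The squares of the generators are pure, so they commute modulo the derived
    subgroup of the pure braid group. *)
Lemma quotient_map_pseudosym n u v : pseudosym_rel u v ->
  word_eval (quotient_map (derived (pure_braid n)) \o generator (@braid_rel n)) u =
  word_eval (quotient_map (derived (pure_braid n)) \o generator (@braid_rel n)) v.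
Proof.
move: u v; apply/pseudosym_familyP; split.
  apply/braid_familyP => u v uv; rewrite -!gmorph_word_eval.
  by congr quotient_map; apply: word_eval_presented.
move=> i j _; rewrite !expg2 -!gmulfM; apply: quotient_derived_commute.
  by rewrite unfold_in gmulfM /= braid_perm_generator tperm2.
by rewrite unfold_in gmulfM /= braid_perm_generator tperm2.
Qed.

Theorem corollary3p3 (n : nat) (hn : 3 <= n) :
  isomorphic (pseudosym_group n) (quotient_group (derived (pure_braid n))).
Proof.
case: n hn => [|[|[|q]]] // _; set N := derived _.
pose f : pseudosym_group q.+3 -> quotient_group N :=
  presented_lift (quotient_map N \o generator (@braid_rel q.+3)).
pose fM := isMultiplicative.Build _ _ f (presented_liftM (@quotient_map_pseudosym _)).
pose F : {multiplicative _ -> _} := HB.pack f fM.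
pose g (c : quotient_group N) := braid_pseudosym (repr c).
have f_pi u : f (\pi_(presented (@pseudosym_rel q.+3)) u) =
    quotient_map N (\pi_(presented (@braid_rel q.+3)) u).
  rewrite /f (presented_lift_pi (@quotient_map_pseudosym _)) -gmorph_word_eval.
  by rewrite word_eval_generator.
have g_pi x : g (quotient_map N x) = braid_pseudosym x.
  have /quotient_eqP : \pi_(quotient_group N) (repr (quotient_map N x)) =
      \pi_(quotient_group N) x by rewrite reprK.
  move/braid_pseudosym_derived; rewrite unfold_in gmulfM gmorphV.
  by move=> /eqP/mulg1_eq; rewrite invgK.
exists F, g => [x|c].
  by elim/quotW: x => u; rewrite [F _]f_pi g_pi braid_pseudosym_pi.
elim/quotW: c => x; rewrite -[\pi_(quotient_group N) x]/(quotient_map N x) g_pi.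
by elim/quotW: x => u; rewrite braid_pseudosym_pi [LHS]f_pi.
Qed.
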